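(* Let $X$ be a Gromov hyperbolic geodesic metric space with bounded growth at some scale. Then the Gromov boundary of $X$ equipped with any Bourdon metric or any Hamenstädt metric is doubling. (A Bourdon metric is a metric $d_{w,\varepsilon}$ on $\partial_\infty X$, and a Hamenstädt metric is a metric $\sigma_{b,\varepsilon}$ on a punctured boundary $\partial_\infty X\setminus\{\xi\}$ with $\xi\in\partial_\infty X$, as defined in the context.)
   Context: A metric space $X$ is of bounded growth at some scale if there exist constants $R>r>0$ and $N\in\mathbb{N}$ such that every open ball of radius $R$ in $X$ can be covered by $N$ open balls of radius $r$. A metric space is doubling if there is a constant $C$ such that every metric ball $B$ can be covered by at most $C$ balls of half the radius of $B$. Gromov hyperbolicity: for a metric space $(X,d)$ the Gromov product is $(x|y)_w=\frac12[d(x,w)+d(y,w)-d(x,y)]$. $X$ is Gromov ($\delta$-)hyperbolic if for some $\delta\ge 0$, $(x|y)_w\ge\min\{(x|z)_w,(z|y)_w\}-\delta$ for all $x,y,z,w\in X$. Gromov boundary: a sequence $\{x_i\}$ in $X$ is a Gromov sequence if $(x_i|x_j)_w\to\infty$ as $i,j\to\infty$; two Gromov sequences $\{x_i\},\{y_i\}$ are equivalent if $(x_i|y_i)_w\to\infty$; $\partial_\infty X$ is the set of equivalence classes. For $a\in X$ and $\eta,\xi\in\partial_\infty X$, $(a|\eta)_w=\inf\{\liminf_{i}(a|b_i)_w:\{b_i\}\in\eta\}$ and $(\xi|\eta)_w=\inf\{\liminf_i(a_i|b_i)_w:\{a_i\}\in\xi,\{b_i\}\in\eta\}$. Bourdon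 metric: for $w\in X$ and $0<\varepsilon<\min\{1,\frac1{5\delta}\}$ put $\rho_{w,\varepsilon}(\xi,\zeta)=e^{-\varepsilon(\xi|\zeta)_w}$ (with $e^{-\infty}=0$) on $\partial_\infty X$, and $d_{w,\varepsilon}(\xi,\zeta)=\inf\sum_{i=1}^n\rho_{w,\varepsilon}(\xi_{i-1},\xi_i)$, the infimum over all $n\ge1$ and finite chains $\xi=\xi_0,\dots,\xi_n=\zeta$ in $\partial_\infty X$. Then $d_{w,\varepsilon}$ is a metric with $\rho_{w,\varepsilon}/2\le d_{w,\varepsilon}\le\rho_{w,\varepsilon}$, called the Bourdon metric based at $w$ with parameter $\varepsilon$. Hamenstädt metric: for $\xi\in\partial_\infty X$ and $w\in X$, the Busemann function based at $\xi$ is $b(x)=b_{\xi,w}(x)=(\xi|w)_x-(\xi|x)_w$, $x\in X$. Put $(x|y)_b=\frac12(b(x)+b(y)-d(x,y))$ for $x,y\in X$, and $(\xi_1|\xi_2)_b=\inf\{\liminf_i(x_i|y_i)_b:\{x_i\}\in\xi_1,\{y_i\}\in\xi_2\}$ for $\xi_1,\xi_2\in\partial_\infty X\setminus\{\xi\}$. For $\varepsilon>0$ with $e^{22\varepsilon\delta}\le2$, put $\rho_{b,\varepsilon}(\xi_1,\xi_2)=e^{-\varepsilon(\xi_1|\xi_2)_b}$ and $\sigma_{b,\varepsilon}(x,y)=\inf\sum_{i=1}^n\rho_{b,\varepsilon}(x_{i-1},x_i)$, the infimum over all $n\ge1$ and finite chains $x=x_0,\dots,x_n=y$ in $\partial_\infty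 X\setminus\{\xi\}$. Then $\sigma_{b,\varepsilon}$ is a metric on $\partial_\infty X\setminus\{\xi\}$ with $\rho_{b,\varepsilon}/2\le\sigma_{b,\varepsilon}\le\rho_{b,\varepsilon}$, called the Hamenstädt metric based at $\xi$ (or at $b$) with parameter $\varepsilon$. *)

(* Defs.v *)
From mathcomp Require Import all_boot all_order all_algebra.
From mathcomp Require Import all_classical all_reals all_analysis.
Set Implicit Arguments.
Unset Strict Implicit.
Unset Printing Implicit Defensive.
Import Order.TTheory GRing.Theory Num.Theory.
Import numFieldNormedType.Exports.
Local Open Scope classical_set_scope.
Local Open Scope ring_scope.

Definition geodesic_space (R : realType) (X : metricType R) : Prop :=
  forall x y : X, exists g : R -> X,
    [/\ g 0 = x, g (mdist x y) = y &
        {in `[0, mdist x y] &, forall s t, mdist (g s) (g t) = `|s - t|}].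

Definition bounded_growth_at_some_scale (R : realType) (X : metricType R) :
    Prop :=
  exists (R0 r0 : R) (N : nat), [/\ 0 < r0, r0 < R0 &
    forall x : X, exists c : 'I_N -> X,
      ball x R0 `<=` \bigcup_(i in [set: 'I_N]) ball (c i) r0].

Definition open_ball_of (R : realType) (T : Type) (d : T -> T -> R)
    (x : T) (r : R) : set T := [set y | d x y < r].

Definition doubling (R : realType) (T : Type) (d : T -> T -> R) : Prop :=
  exists C : nat, forall (x : T) (r : R), 0 < r ->
    exists2 n : nat, (n <= C)%N & exists c : 'I_n -> T,
      open_ball_of d x r `<=`
        \bigcup_(i in [set: 'I_n]) open_ball_of d (c i) (r / 2).

Definition gromov_prod (R : realType) (X : metricType R) (w x y : X) : R :=
  2^-1 * (mdist x w + mdist y w - mdist x y).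

Definition delta_hyperbolic (R : realType) (X : metricType R) (delta : R) :
    Prop :=
  0 <= delta /\ forall x y z w : X,
    Num.min (gromov_prod w x z) (gromov_prod w z y) - delta
      <= gromov_prod w x y.

Definition gromov_hyperbolic (R : realType) (X : metricType R) : Prop :=
  exists delta : R, delta_hyperbolic X delta.

(* Changing the base point w changes gromov_prod w x y by at most the distance
   between the two base points, so "for all w" below is the same as "for one
   w" and spares the choice of a base point. *)
Definition gromov_seq (R : realType) (X : metricType R) (a : nat -> X) : Prop :=
  forall w : X, gromov_prod w (a ij.1) (a ij.2) @[ij --> (\oo, \oo)] --> +oo.

Definition gromov_equiv (R : realType) (X : metricType R) (a b : nat -> X) :
    Prop :=
  forall w : X, gromov_prod w (a i) (b i) @[i --> \oo] --> +oo.

Definition gromov_class (R : realType) (X : metricType R) (a : nat -> X) :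
    set (nat -> X) :=
  [set b | gromov_seq b /\ gromov_equiv a b].

(* A boundary point xi is an equivalence class; its representatives are the
   elements of the set val xi. *)
Definition gromov_boundary (R : realType) (X : metricType R) : Type :=
  set_type [set gromov_class a | a in @gromov_seq R X].

Definition punctured_boundary (R : realType) (X : metricType R)
    (xi : gromov_boundary X) : Type :=
  set_type (~` [set xi]).

Definition gromov_prod_pt (R : realType) (X : metricType R) (w a : X)
    (eta : gromov_boundary X) : \bar R :=
  ereal_inf [set limn_einf (fun i => (gromov_prod w a (b i))%:E)
            | b in val eta].

(* Extension of a product g on X to the boundary, used both for the Gromov
   product based at a point and for the one based at a Busemann function. *)
Definition boundary_prod (R : realType) (X : metricType R) (g : X -> X -> R)
    (xi eta : gromov_boundary X) : \bar R :=
  ereal_inf [set limn_einf (fun i => (g (ab.1 i) (ab.2 i))%:E)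
            | ab in val xi `*` val eta].

(* exp(- eps * t); it is 0 at t = +oo. Since fine +oo = 0, the value at
   t = -oo is meaningless, but the boundary products to which it is applied
   are never -oo in a hyperbolic space. *)
Definition exp_gauge (R : realType) (eps : R) (t : \bar R) : R :=
  fine (expeR (- (eps%:E * t))%E).

Definition chain_metric (R : realType) (T : Type) (rho : T -> T -> R)
    (x y : T) : R :=
  inf [set s | exists (n : nat) (c : nat -> T),
    [/\ (0 < n)%N, c 0%N = x, c n = y &
        s = \sum_(i < n) rho (c i) (c i.+1)]].

Definition bourdon_metric (R : realType) (X : metricType R) (w : X) (eps : R) :
    gromov_boundary X -> gromov_boundary X -> R :=
  chain_metric (fun xi zeta => exp_gauge eps (boundary_prod (gromov_prod w) xi zeta)).

(* 0 < eps < min(1, 1 / (5 delta)), with 1 / 0 read as infinity. *)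
Definition bourdon_parameter (R : realType) (delta eps : R) : Prop :=
  [/\ 0 < eps, eps < 1 & eps * (5 * delta) < 1].

(* Both terms lie in [0, mdist w x], so fine discards nothing. *)
Definition busemann (R : realType) (X : metricType R)
    (xi : gromov_boundary X) (w x : X) : R :=
  fine (gromov_prod_pt x w xi) - fine (gromov_prod_pt w x xi).

Definition busemann_prod (R : realType) (X : metricType R) (b : X -> R)
    (x y : X) : R :=
  2^-1 * (b x + b y - mdist x y).

Definition hamenstadt_metric (R : realType) (X : metricType R)
    (xi : gromov_boundary X) (w : X) (eps : R) :
    punctured_boundary xi -> punctured_boundary xi -> R :=
  chain_metric (fun xi1 xi2 : punctured_boundary xi =>
    exp_gauge eps (boundary_prod (busemann_prod (busemann xi w))
                                 (val xi1) (val xi2))).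

Definition hamenstadt_parameter (R : realType) (delta eps : R) : Prop :=
  0 < eps /\ expR (22 * eps * delta) <= 2.

(* Main.v *)
Require Import Defs.
From mathcomp Require Import all_boot all_order all_algebra.
From mathcomp Require Import all_classical all_reals all_analysis.
From mathcomp Require Import ring lra.

(** Why the boundary is doubling.

    Fix a Gromov product g on X, either the one based at a point w or the one
    based at a Busemann function b.  Both satisfy the four-point inequality
    up to a constant k, namely delta and 3 delta; for b the reason is that
    b(x) is about d(a, x) - d(a, w) for a close to the boundary point xi, with
    error delta, so that (x|y)_b is about (x|y)_a - d(a, w) for such a.  The
    inequality passes to the boundary with the same constant, so the gauge
    rho = exp(- eps (.|.)_g) satisfies rho(x,z) <= K max(rho(x,y), rho(y,z))
    with K = exp(eps k), and the restrictions on eps give K^2 <= 2.  By Frink's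
    argument ([quasi_le_chain_sum]) the chain metric is then between rho / 2 and
    rho, and doubling becomes a statement about products
    ([doubling_boundary_gauge]): for each L, every set of boundary points whose
    product with some centre exceeds t must be covered by a number of sets with
    product at least t + L, this number depending on L only.

    For products based at a point a this is [boundary_covering].  Send each
    boundary point eta of the set to a point of X at distance T from a in the
    direction of eta, where T exceeds t by a constant.  Products close to T make
    these points of X lie in one ball of bounded radius, which bounded growth and
    geodesicity cover by boundedly many balls of the small growth radius
    ([bounded_growth_all_scales]).  If two of the points lie in the same small
    ball, the product of the corresponding boundary points is at least T minus
    a constant.  No geodesic ray is used, and X need not be proper: the point in
    the direction of eta lies on a segment from a to a far term of a sequence
    converging to eta.

    The case of a Busemann function reduces to the same covering with a base
    point a close to xi.  The number of sets does not depend on a, but a single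
    a must serve all points of the set {eta | (xi0|eta)_b > t}.  It does because
    such points stay away from xi: their products with xi based at w are bounded
    ([busemann_level_bounded]), and on the region of X where the products with
    xi are bounded, b(x) is d(a, x) - d(a, w) up to a constant for one fixed a
    ([busemann_approx]). *)

Set Implicit Arguments.
Unset Strict Implicit.
Unset Printing Implicit Defensive.
Import Order.TTheory GRing.Theory Num.Theory.
Local Open Scope classical_set_scope.
Local Open Scope ring_scope.

Local Notation gp := gromov_prod.

(** * Chain metrics of quasi-ultrametric gauges *)

Section ChainMetric.
Variables (R : realType) (T : Type) (rho : T -> T -> R) (K : R).
Hypothesis rho_ge0 : forall x y, 0 <= rho x y.
Hypothesis rho_quasi :
  forall x y z, rho x z <= K * Num.max (rho x y) (rho y z).
Hypotheses (K_ge1 : 1 <= K) (K2_le2 : K ^+ 2 <= 2).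

(** Frink's argument: cut the chain at the last vertex p where the sum of the
    previous steps is at most half of the total S.  The steps after p.+1 then
    also add up to at most S / 2, and both parts are shorter, so by induction
    each is bridged by a step of gauge at most S; recombining the two parts and
    the step from p to p.+1 costs at most K^2 <= 2. *)
Lemma quasi_le_chain_sum n (c : nat -> T) : (0 < n)%N ->
  rho (c 0%N) (c n) <= 2 * \sum_(i < n) rho (c i) (c i.+1).
Proof.
elim/ltn_ind: n c => n IH c n0.
pose f i := rho (c i) (c i.+1).
pose pre p := \sum_(0 <= i < p) f i.
have -> : \sum_(i < n) rho (c i) (c i.+1) = pre n by rewrite /pre big_mkord.
set S := pre n.
have f0 i : 0 <= f i by exact: rho_ge0.
have S0 : 0 <= S by apply: sumr_ge0.
(* The bound p < n makes the step from p to p.+1 exist, even when S = 0. *)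
pose P p := (p < n)%N && (pre p <= S / 2).
have exP : exists p, P p.
  by exists 0%N; rewrite /P n0 /pre big_geq//= divr_ge0.
have ubP p : P p -> (p <= n)%N by case/andP => /ltnW.
case: (ex_maxnP exP ubP) => p /andP[pn preS] pmax {exP ubP}.
have splitS : S = pre p + f p + \sum_(p.+1 <= i < n) f i.
  rewrite /S /pre (big_cat_nat (n := p.+1)) ?big_nat_recr//.
have suf0 : 0 <= \sum_(p.+1 <= i < n) f i by apply: sumr_ge0.
have pre0 : 0 <= pre p by apply: sumr_ge0.
have head : (0 < p)%N -> rho (c 0%N) (c p) <= S.
  move=> p0; have := IH p pn c p0; rewrite -(big_mkord xpredT f) -/(pre p).
  by move: preS; lra.
have fpS : f p <= S by move: splitS; lra.
have K0 : 0 <= K by apply: le_trans K_ge1.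
have K2 : K <= 2.
  by rewrite leNgt; apply/negP => ?; move: K2_le2; rewrite expr2; nra.
have leS x : x <= S -> x <= K * S.
  by move=> xS; apply: (le_trans xS); rewrite ler_peMl.
have tail : rho (c p) (c n) <= K * S.
  have [pn1|] := leqP n p.+1.
    have -> : n = p.+1 by apply/eqP; rewrite eqn_leq pn1.
    exact: leS.
  move=> pn1.
  have sufS : \sum_(p.+1 <= i < n) f i <= S / 2.
    have : ~~ P p.+1 by apply/negP => /pmax; rewrite ltnn.
    rewrite /P pn1/= -ltNge /pre big_nat_recr//= -/(pre p) => ?.
    by move: splitS; lra.
  apply: (le_trans (rho_quasi _ (c p.+1) _)).
  rewrite ler_wpM2l// ge_max fpS/=.
  have := IH (n - p.+1)%N _ (fun i => c (p.+1 + i)%N).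
  rewrite addn0 subnKC// subn_gt0 => /(_ _ pn1).
  rewrite ltn_subrL n0/= => /(_ isT).
  have -> : \sum_(i < n - p.+1) rho (c (p.+1 + i)%N) (c (p.+1 + i.+1)%N) =
            \sum_(p.+1 <= i < n) f i.
    rewrite -[X in \sum_(X <= _ < _) _]add0n big_addn big_mkord.
    apply: eq_bigr => i _.
    by rewrite /f addnS addnC.
  by move: sufS; lra.
(* rho (c 0) (c 0) need not vanish, so an empty first part is not bridged. *)
have [p0|p0] := posnP p.
  by rewrite p0 in tail; apply: (le_trans tail); rewrite ler_wpM2r.
apply: (le_trans (rho_quasi _ (c p) _)).
apply: (@le_trans _ _ (K * Num.max S (K * S))).
  rewrite ler_wpM2l// ge_max !le_max head//= tail orbT//.
have [_|_] := leP S (K * S); last by rewrite ler_wpM2r.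
by rewrite mulrA -expr2 ler_wpM2r.
Qed.

Let chain_sums x y := [set s | exists (n : nat) (c : nat -> T),
    [/\ (0 < n)%N, c 0%N = x, c n = y &
        s = \sum_(i < n) rho (c i) (c i.+1)]].

Let rho_chain_sums x y : chain_sums x y (rho x y).
Proof.
exists 1%N, (fun i => if i is 0%N then x else y); split=> //.
by rewrite big_ord_recl big_ord0 addr0.
Qed.

Lemma chain_metric_le x y : chain_metric rho x y <= rho x y.
Proof.
apply: ge_inf; last exact: rho_chain_sums.
by exists 0 => _ [n [c [_ _ _ ->]]]; apply: sumr_ge0.
Qed.

Lemma quasi_le_chain_metric x y : rho x y <= 2 * chain_metric rho x y.
Proof.
rewrite -ler_pdivrMl//; apply: lb_le_inf.
  by exists (rho x y); exact: rho_chain_sums.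
move=> _ [n [c [n0 <- <- ->]]]; rewrite ler_pdivrMl//.
exact: quasi_le_chain_sum.
Qed.

(** Passing between the gauge and its chain metric loses a factor 2, so halving
    the radius for the metric takes a factor 4 for the gauge. *)
Lemma doubling_chain_metric (I : finType) :
  (forall x r, 0 < r -> exists c : I -> T,
     forall y, rho x y < r -> exists i, rho (c i) y < r / 4) ->
  doubling (chain_metric rho).
Proof.
move=> cover; exists #|I| => x r r0; exists #|I| => //.
have [c cP] := cover x (2 * r) (mulr_gt0 (ltr0Sn _ 1) r0).
exists (c \o enum_val) => y /= dxy; have [|i ciy] := cP y.
  by apply: (le_lt_trans (quasi_le_chain_metric x y)); rewrite ltr_pM2l.
exists (enum_rank i) => //=; rewrite /open_ball_of/= enum_rankK.
by apply: (le_lt_trans (chain_metric_le _ _)); apply: (lt_le_trans ciy); lra.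
Qed.

End ChainMetric.

Section ExpGauge.
Variables (R : realType) (eps : R).
Hypothesis eps0 : 0 < eps.

Lemma exp_gauge_ge0 t : 0 <= exp_gauge eps t.
Proof. by apply: fine_ge0; exact: expeR_ge0. Qed.

Lemma exp_gauge_le (s : R) t : (s%:E <= t)%E ->
  exp_gauge eps t <= expR (- (eps * s)).
Proof.
case: t => [t| |]; rewrite /exp_gauge ?leeNy_eq//=.
  by rewrite lee_fin ler_expR lerN2 ler_pM2l.
by move=> _; rewrite gt0_muley ?lte_fin//= expR_ge0.
Qed.

(** The value -oo is excluded because there the gauge takes the spurious
    value 0. *)
Lemma exp_gauge_gt t (m : R) : 0 < m -> t != -oo%E -> exp_gauge eps t < m ->
  ((- (ln m / eps))%:E < t)%E.
Proof.
case: t => [t| |]//= m0 _; rewrite /exp_gauge ?ltry//=.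
rewrite -{1}(lnK (x := m)) ?posrE// ltr_expR lte_fin => tm.
by rewrite -ltrN2 opprK ltr_pdivlMr// in tm *; lra.
Qed.

End ExpGauge.

(** * Products on the boundary *)

Section BoundaryProduct.
Variables (R : realType) (X : metricType R).
Implicit Types (xi eta zeta : gromov_boundary X) (g : X -> X -> R).

Let limn_einf_sup_einfs (v : nat -> \bar R) :
  limn_einf v = ereal_sup (range (einfs v)).
Proof. by rewrite limn_einf_lim; apply/cvg_lim => //; exact: cvg_einfs_sup. Qed.

Lemma lt_limn_einf (u : nat -> R) s :
  (s%:E < limn_einf (fun i => (u i)%:E))%E -> \forall i \near \oo, s < u i.
Proof.
rewrite limn_einf_sup_einfs => /ereal_sup_gt[_ [N _ <-] sN].
exists N => //= i Ni; rewrite -lte_fin.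
by apply: (lt_le_trans sN); apply: ereal_inf_lbound; exists i.
Qed.

Lemma le_limn_einf (u : nat -> R) s :
  (\forall i \near \oo, s <= u i) -> (s%:E <= limn_einf (fun i => (u i)%:E))%E.
Proof.
move=> [N _ sN]; rewrite limn_einf_sup_einfs.
apply: le_trans (ereal_sup_ubound _); last by exists N.
by apply: le_ereal_inf_tmp => _ [i /= Ni <-]; rewrite lee_fin; exact: sN.
Qed.

(** A strict bound on the infimum of lower limits becomes a bound on almost all
    terms, for all pairs of representatives; with [boundary_prod_ge] this lets
    every later estimate be made on points of X. *)
Lemma boundary_prod_gt g xi eta s : (s%:E < boundary_prod g xi eta)%E ->
  forall x y, val xi x -> val eta y -> \forall i \near \oo, s < g (x i) (y i).
Proof.
move=> sg x y xix etay; apply: lt_limn_einf; apply: (lt_le_trans sg).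
by apply: ereal_inf_lbound; exists (x, y).
Qed.

Lemma boundary_prod_ge g xi eta s :
  (forall x y, val xi x -> val eta y -> \forall i \near \oo, s <= g (x i) (y i)) ->
  (s%:E <= boundary_prod g xi eta)%E.
Proof.
move=> sg; apply: le_ereal_inf_tmp => _ [[x y] [/= xix etay] <-].
by apply: le_limn_einf; exact: sg.
Qed.

(** The four-point inequality g x y >= min(g x z, g z y) - k, by thresholds: a
    lower bound common to both terms is what is at hand whenever it is used,
    and steps compose without minima. *)
Definition quasi_ultra g (k : R) :=
  forall x y z s, s <= g x z -> s <= g z y -> s - k <= g x y.

Lemma boundary_point_class xi :
  exists2 a, gromov_seq a & val xi = gromov_class a.
Proof. by case: xi => A /= /set_mem[a ga <-]; exists a. Qed.

Lemma boundary_rep_gromov xi x : val xi x -> gromov_seq x.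
Proof. by have [a _ ->] := boundary_point_class xi => -[]. Qed.

Lemma boundary_rep_exists xi : exists x, val xi x.
Proof.
have [a ga ->] := boundary_point_class xi; exists a; split=> // w.
apply/cvgryPge => s; have /cvgryPge/(_ s) := ga w.
move=> [[P Q] [[N1 _ N1P] [N2 _ N2P]] PQ].
exists (maxn N1 N2) => // i /=; rewrite geq_max => /andP[i1 i2].
by apply: (PQ (i, i)); split; [exact: N1P|exact: N2P].
Qed.

(** The constant is the same as on X: the four-point inequality holds term by
    term, with any representative of zeta in the middle. *)
Lemma boundary_prod_quasi g k xi eta zeta s : quasi_ultra g k ->
  (s%:E < boundary_prod g xi zeta)%E -> (s%:E < boundary_prod g zeta eta)%E ->
  ((s - k)%:E <= boundary_prod g xi eta)%E.
Proof.
move=> gk s1 s2; have [z zz] := boundary_rep_exists zeta.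
apply: boundary_prod_ge => x y xx yy.
have := boundary_prod_gt s1 xx zz; have := boundary_prod_gt s2 zz yy.
by apply: filterS2 => i /ltW h1 /ltW h2; apply: gk h2 h1.
Qed.

End BoundaryProduct.

Section BoundaryGauge.
Variables (R : realType) (X : metricType R) (T : Type).
Variables (f : T -> gromov_boundary X) (g : X -> X -> R) (k eps : R).
Hypotheses (gk : quasi_ultra g k) (k_ge0 : 0 <= k).
Hypotheses (eps0 : 0 < eps) (epsk : expR (2 * eps * k) <= 2).
Hypothesis prod_ninfty : forall x y, boundary_prod g (f x) (f y) != -oo%E.

Let rho x y := exp_gauge eps (boundary_prod g (f x) (f y)).

Lemma boundary_gauge_quasi x y z :
  rho x z <= expR (eps * k) * Num.max (rho x y) (rho y z).
Proof.
have step m : 0 < m -> rho x y < m -> rho y z < m -> rho x z <= expR (eps * k) * m.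
  move=> m0 /(exp_gauge_gt eps0 m0 (prod_ninfty _ _)) xy.
  move=> /(exp_gauge_gt eps0 m0 (prod_ninfty _ _)) yz.
  have := exp_gauge_le eps0 (boundary_prod_quasi gk xy yz).
  rewrite (_ : - _ = eps * k + ln m) ?expRD ?lnK ?posrE//.
  by field; rewrite gt_eqF.
(* The bound for all m > max extends to the maximum by density. *)
rewrite -ler_pdivrMl ?expR_gt0//; apply/ler_addgt0Pr => e e0.
rewrite ler_pdivrMl ?expR_gt0//.
have m0 : 0 <= Num.max (rho x y) (rho y z) by rewrite le_max exp_gauge_ge0.
apply: step; first by rewrite ltr_wpDl.
- by apply: (@le_lt_trans _ _ (Num.max (rho x y) (rho y z)));
    rewrite ?ltrDl// le_max lexx.
- by apply: (@le_lt_trans _ _ (Num.max (rho x y) (rho y z)));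
    rewrite ?ltrDl// le_max lexx orbT.
Qed.

(** Balls for the gauge are superlevel sets of the product, and dividing the
    radius by a factor adds a constant to the level; hence doubling follows if
    raising the level by L costs a number of sets independent of the level. *)
Lemma doubling_boundary_gauge :
  (forall L, exists I : finType, forall x t, exists c : I -> T,
     forall y, (t%:E < boundary_prod g (f x) (f y))%E ->
       exists i, ((t + L)%:E <= boundary_prod g (f (c i)) (f y))%E) ->
  doubling (chain_metric rho).
Proof.
(* L = ln 4 / eps would only give a large inequality. *)
move=> /(_ (ln 8 / eps))[I cover].
apply: (@doubling_chain_metric _ _ _ (expR (eps * k)) _ _ _ _ I).
- by move=> x y; exact: exp_gauge_ge0.
- exact: boundary_gauge_quasi.
- by rewrite -expR0 ler_expR mulr_ge0// ltW.
- by rewrite -expRM_natl mulrA.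
move=> x r r0; have [c cP] := cover x (- (ln r / eps)).
exists c => y /(exp_gauge_gt eps0 r0 (prod_ninfty _ _))/cP[i ciy]; exists i.
apply: (le_lt_trans (exp_gauge_le eps0 ciy)).
rewrite (_ : - _ = ln (r / 8)); last first.
  by rewrite ln_div ?posrE//; field; rewrite gt_eqF.
by rewrite lnK ?posrE ?divr_gt0// ltr_pM2l// ltf_pV2 ?posrE// ltr_nat.
Qed.

End BoundaryGauge.

(** * Gromov products in a hyperbolic space *)

Section Hyperbolic.
Variables (R : realType) (X : metricType R) (delta : R).
Hypothesis hyp : delta_hyperbolic X delta.
Implicit Types (w p q : X) (x y z u : nat -> X) (xi eta : gromov_boundary X).

Lemma gromov_prodC w p q : gp w p q = gp w q p.
Proof. by rewrite /gp (metric_sym p q); lra. Qed.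

Lemma gromov_prod_ge0 w p q : 0 <= gp w p q.
Proof.
by have := metric_triangle p w q; rewrite /gp (metric_sym w q); lra.
Qed.

Lemma gromov_prod_le w p q : gp w p q <= mdist p w.
Proof.
have := metric_triangle q p w; rewrite /gp (metric_sym q p); lra.
Qed.

Lemma gromov_prod_base w w' p q : gp w p q <= gp w' p q + mdist w w'.
Proof.
have := metric_triangle p w' w; have := metric_triangle q w' w.
by rewrite /gp (metric_sym w' w); lra.
Qed.

Lemma gromov_prodxx w p : gp w p p = mdist p w.
Proof. by rewrite /gp mdistxx; lra. Qed.

Lemma delta_ge0 : 0 <= delta. Proof. by case: hyp. Qed.

Lemma gromov_prod_quasi w : quasi_ultra (gp w) delta.
Proof.
move=> p q r s spr srq; case: hyp => _ /(_ p q r w); apply: le_trans.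
by rewrite lerD2r le_min spr.
Qed.

Lemma boundary_rep_near xi x y w s : val xi x -> val xi y ->
  \forall i \near \oo, s <= gp w (x i) (y i).
Proof.
have [a _ ->] := boundary_point_class xi => -[_ ax] [_ ay].
have /cvgryPge/(_ (s + delta)) := ax w.
have /cvgryPge/(_ (s + delta)) := ay w.
apply: filterS2 => i ayi axi; rewrite -(addrK delta s).
by apply: gromov_prod_quasi ayi; rewrite gromov_prodC.
Qed.

(** Two independent indices: this contains both that a representative is a
    Gromov sequence and that two representatives are equivalent. *)
Lemma boundary_rep_near2 xi x y w s : val xi x -> val xi y ->
  exists N, forall i j, (N <= i)%N -> (N <= j)%N -> s <= gp w (x i) (y j).
Proof.
move=> xix xiy; have [N1 _ N1P] := boundary_rep_near w (s + delta) xix xiy.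
have /cvgryPge/(_ (s + delta)) := boundary_rep_gromov xix w.
move=> [[P Q] [[N2 _ N2P] [N3 _ N3P]] PQ].
exists (maxn N1 (maxn N2 N3)) => i j; rewrite !geq_max.
move=> /and3P[_ i2 _] /and3P[j1 _ j3]; rewrite -(addrK delta s).
apply: (@gromov_prod_quasi w _ _ (x j)); last exact: N1P.
by apply: (PQ (i, j)); split; [exact: N2P|exact: N3P].
Qed.

Lemma boundary_point_eq xi eta x y : val xi x -> val eta y ->
  gromov_equiv x y -> xi = eta.
Proof.
move=> xix etay xy; apply: val_inj.
suff sub xi' eta' x' y' : val xi' x' -> val eta' y' ->
    gromov_equiv x' y' -> val xi' `<=` val eta'.
  apply/seteqP; split; first exact: sub xix etay xy.
  apply: sub etay xix _ => w; apply: cvg_trans (xy w).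
  by apply: near_eq_cvg; apply: nearW => i; rewrite gromov_prodC.
move=> {xi eta x y xix etay xy} xix etay xy z xiz.
have gz := boundary_rep_gromov xiz.
have [b _ etaE] := boundary_point_class eta'; rewrite etaE in etay *.
case: etay => _ bY; split=> // w; apply/cvgryPge => s.
have /cvgryPge/(_ (s + delta)) := bY w.
have /cvgryPge/(_ (s + delta + delta)) := xy w.
have := boundary_rep_near w (s + delta + delta) xix xiz.
apply: filterS3 => i h1 h2 h3; rewrite -(addrK delta s).
apply: (gromov_prod_quasi h3); rewrite -(addrK delta (s + delta)).
by apply: gromov_prod_quasi h1; rewrite gromov_prodC.
Qed.

(** If some terms z j and u m, arbitrarily far out, had arbitrarily large
    products, z being a representative of eta, then the four-point inequality
    would make the products of z i and u i tend to infinity, and eta would be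
    xi.  Any representative x
    of eta can be compared with z at a cost of delta, which makes the bound S
    uniform in x. *)
Lemma gromov_prod_bounded xi eta u w : eta <> xi -> val xi u ->
  exists S, forall x, val eta x -> exists N, forall i j,
    (N <= i)%N -> (N <= j)%N -> gp w (x i) (u j) <= S.
Proof.
move=> etaxi xiu; have [z etaz] := boundary_rep_exists eta.
have [w' [A zuA]] : exists w' A, forall N, exists2 i, (N <= i)%N &
    gp w' (z i) (u i) < A.
  apply: contrapT => H; apply: etaxi; apply: boundary_point_eq etaz xiu _.
  move=> w'; apply/cvgryPge => A; apply: contrapT => nA; apply: H.
  exists w', A => N; apply: contrapT => nN; apply: nA; exists N => // i /= Ni.
  by rewrite leNgt; apply/negP => iA; apply: nN; exists i.
pose S0 := A + mdist w w' + delta + delta.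
have [N1 zz] := boundary_rep_near2 w S0 etaz etaz.
have [N2 uu] := boundary_rep_near2 w S0 xiu xiu.
pose N := maxn N1 N2.
have [i Ni zuiA] := zuA N.
have N12 j : (N <= j)%N -> (N1 <= j)%N /\ (N2 <= j)%N.
  by rewrite geq_max => /andP.
have zu j m : (N <= j)%N -> (N <= m)%N -> gp w (z j) (u m) <= S0.
  move=> /N12[j1 j2] /N12[m1 m2]; rewrite leNgt; apply/negP => /ltW jm.
  have [i1 i2] := N12 _ Ni.
  have := gromov_prod_quasi (gromov_prod_quasi (zz _ _ i1 j1) jm)
    (le_trans _ (uu _ _ m2 i2)).
  rewrite lerBlDr lerDl => /(_ delta_ge0).
  by have := gromov_prod_base w w' (z i) (u i); rewrite /S0; lra.
exists (S0 + delta + 1) => x etax.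
have [N3 zx] := boundary_rep_near2 w (S0 + delta + 1) etaz etax.
exists (maxn N N3) => j m; rewrite ![(maxn N _ <= _)%N]geq_max.
move=> /andP[jN j3] /andP[mN m3].
rewrite leNgt; apply/negP => /ltW xu.
by have := gromov_prod_quasi (zx _ _ j3 j3) xu; have := zu _ _ jN mN; lra.
Qed.

End Hyperbolic.

(** * Covering subsets of the boundary *)

Section BoundedGrowth.
Variables (R : realType) (X : metricType R).
Hypothesis geo : geodesic_space X.

Lemma geodesic_point (x y : X) s : 0 <= s <= mdist x y ->
  exists2 p, mdist x p = s & mdist p y = mdist x y - s.
Proof.
move=> /andP[s0 sd]; have [g [g0 g1 gI]] := geo x y; exists (g s).
  rewrite -{1}g0 gI ?in_itv/= ?lexx ?s0//; last by rewrite (le_trans s0).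
  by rewrite sub0r normrN ger0_norm.
rewrite -{1}g1 gI ?in_itv/= ?lexx ?s0 ?sd//; last by rewrite (le_trans s0).
by rewrite distrC ger0_norm// subr_ge0.
Qed.

(** If balls of radius s are covered by balls of radius r, then balls of radius
    s + h are covered by balls of radius r + h as soon as points can be moved by
    h towards the centre, and the growth condition brings r + h < R0 back to r
    at the cost of a factor N.  The step h is half of R0 - r to keep the
    inequalities strict. *)
Lemma bounded_growth_all_scales : bounded_growth_at_some_scale X ->
  exists2 r : R, 0 < r & forall D : R, exists I : finType, forall x : X,
    exists q : I -> X, forall y, mdist x y < D -> exists i, mdist (q i) y < r.
Proof.
move=> [R0 [r [N [r0 rR0 cover]]]]; exists r => // D.
have cover0 x : exists c : 'I_N -> X, forall y, mdist x y < R0 ->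
    exists i, mdist (c i) y < r.
  have [c cP] := cover x; exists c => y xy.
  have := cP y; rewrite ballEmdist/= => /(_ xy)[i _].
  by rewrite ballEmdist; exists i.
pose h := (R0 - r) / 2; have h0 : 0 < h by rewrite divr_gt0// subr_gt0.
suff [n nD] : exists n : nat, D <= R0 + n%:R * h.
  suff [I IP] : exists I : finType, forall x : X, exists q : I -> X,
      forall y, mdist x y < R0 + n%:R * h -> exists i, mdist (q i) y < r.
    exists I => x; have [q qP] := IP x; exists q => y xy.
    by apply: qP; apply: lt_le_trans xy nD.
  elim: n {nD} => [|n [I IP]].
    by exists 'I_N => x; rewrite mul0r addr0; exact: cover0.
  exists (I * 'I_N)%type => x; have [q qP] := IP x.
  have [c cP] := choice cover0.
  exists (fun ij => c (q ij.1) ij.2) => y xy.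
  have [p xp py] : exists2 p, mdist x p < R0 + n%:R * h & mdist p y <= h.
    have [xyh|hxy] := leP (mdist x y) h.
      exists x; rewrite ?mdistxx// ltr_wpDr ?(lt_trans r0)//.
      by rewrite mulr_ge0// ltW.
    have [|p xp py] := @geodesic_point x y (mdist x y - h).
      by rewrite subr_ge0 ltW//= gerBl ltW.
    exists p; last by rewrite py opprB addrC subrK.
    by rewrite xp; move: xy; rewrite -natr1; lra.
  have [i qip] := qP p xp.
  have [|j cy] := cP (q i) y; last by exists (i, j).
  apply: (le_lt_trans (metric_triangle _ p _)).
  by move: h0 qip py; rewrite /h; lra.
exists (Num.truncn ((D - R0) / h)).+1; rewrite -lerBlDl -ler_pdivrMr//.
by rewrite ltW// truncnS_gt.
Qed.

End BoundedGrowth.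

Section Covering.
Variables (R : realType) (X : metricType R) (delta : R).
Hypotheses (hyp : delta_hyperbolic X delta) (geo : geodesic_space X).

(** Substitute for the point at time t on a geodesic ray from a to eta, which
    may fail to exist: p lies on a segment from a to a term b N so far out that
    b N has product at least t with all later terms of b. *)
Lemma point_towards (a : X) (eta : gromov_boundary X) (t : R) : 0 <= t ->
  exists2 p, mdist a p = t & forall y, val eta y ->
    \forall j \near \oo, t - 2 * delta <= gp a p (y j).
Proof.
move=> t0; have [b etab] := boundary_rep_exists eta.
have [N bb] := boundary_rep_near2 hyp a t etab etab.
have tN : t <= mdist a (b N) by rewrite metric_sym -gromov_prodxx; exact: bb.
have [|p ap pb] := @geodesic_point _ _ geo a (b N) t; first by rewrite t0.
exists p => // y etay.
have := boundary_rep_near hyp a t etab etay.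
have : \forall j \near \oo, (N <= j)%N by exists N.
apply: filterS2 => j Nj bjyj.
have pbN : gp a p (b N) = t.
  by rewrite /gp (metric_sym p a) (metric_sym (b N) a) ap pb; lra.
have h1 : t - delta <= gp a (b N) (y j).
  by apply: gromov_prod_quasi hyp _ _ _ _ _ (bb _ _ _ _) bjyj.
have := @gromov_prod_quasi _ _ _ hyp a p (y j) (b N) (t - delta) _ h1.
rewrite (_ : t - delta - delta = t - 2 * delta); last by ring.
by apply; rewrite pbN gerBl (delta_ge0 hyp).
Qed.

(** Level sets are sent to X at height t, a constant L1 above s.  Hyperbolicity
    keeps the image within bounded distance of any of its points, and two
    boundary points whose images share a ball of radius r have product at least
    t - r - 4 delta, which is s + L by the choice of L1.  The finite type I
    depends on L only, in particular neither on the base point nor on s. *)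
Lemma boundary_covering : bounded_growth_at_some_scale X ->
  forall L, exists I : finType,
  forall (T : Type) (f : T -> gromov_boundary X) (A : set T) (x0 : T) a s,
  (forall eta zeta x y, A eta -> A zeta -> val (f eta) x -> val (f zeta) y ->
     \forall i \near \oo, s <= gp a (x i) (y i)) ->
  exists c : I -> T, forall zeta, A zeta -> exists i, A (c i) /\
    forall x y, val (f (c i)) x -> val (f zeta) y ->
     \forall i \near \oo, s + L <= gp a (x i) (y i).
Proof.
move=> /(bounded_growth_all_scales geo)[r r0 cover] L.
have d0 := delta_ge0 hyp.
pose L1 := Num.max L 0 + r + 4 * delta.
have L10 : 0 <= L1 by rewrite !addr_ge0 ?le_max ?lexx ?orbT ?mulr_ge0// ltW.
have LL1 : L <= L1 - r - 4 * delta.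
  have : L <= Num.max L 0 by rewrite le_max lexx.
  by rewrite /L1; lra.
have [I cov] := cover (2 * (L1 + 4 * delta) + 1).
exists I => T f A x0 a s sA.
have [[eta0 A0]|noA] := pselect (exists eta, A eta); last first.
  by exists (fun=> x0) => zeta Az; exfalso; apply: noA; exists zeta.
(* A height must be nonnegative, whereas s may be very negative. *)
pose t := Num.max (s + L1) 0.
have t0 : 0 <= t by rewrite le_max lexx orbT.
have st : s + L1 <= t by rewrite le_max lexx.
have /choice[p pP] : forall eta : T, exists p, mdist a p = t /\
    forall y, val (f eta) y -> \forall j \near \oo, t - 2 * delta <= gp a p (y j).
  by move=> eta; have [p] := point_towards a (f eta) t0; exists p.
have close eta zeta : A eta -> A zeta ->
    mdist (p eta) (p zeta) <= 2 * (L1 + 4 * delta).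
  move=> Aeta Azeta.
  have [x etax] := boundary_rep_exists (f eta).
  have [y zetay] := boundary_rep_exists (f zeta).
  have [ap /(_ _ etax) px] := pP eta; have [aq /(_ _ zetay) qy] := pP zeta.
  have xy := sA _ _ _ _ Aeta Azeta etax zetay.
  near \oo => i.
  have pxi : t - L1 - 2 * delta <= gp a (p eta) (x i).
    by have : t - 2 * delta <= gp a (p eta) (x i); [near: i|lra].
  have yqi : t - L1 - 2 * delta <= gp a (y i) (p zeta).
    rewrite gromov_prodC.
    by have : t - 2 * delta <= gp a (p zeta) (y i); [near: i|lra].
  have xyi : t - L1 - 2 * delta <= gp a (x i) (y i).
    have : s <= gp a (x i) (y i) by near: i.
    have := gromov_prod_ge0 a (x i) (y i).
    by rewrite /t; case: (leP (s + L1) 0) => _; lra.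
  have yqi' : t - L1 - 2 * delta - delta <= gp a (y i) (p zeta).
    by apply: le_trans yqi; lra.
  have := gromov_prod_quasi hyp (gromov_prod_quasi hyp pxi xyi) yqi'.
  rewrite {1}/gp.
  by rewrite (metric_sym (p eta) a) (metric_sym (p zeta) a) ap aq; lra.
have [q qP] := cov (p eta0).
have /choice[c cP] : forall i, exists eta : T, forall zeta, A zeta ->
    mdist (q i) (p zeta) < r -> A eta /\ mdist (q i) (p eta) < r.
  move=> i; have [[eta [? ?]]|no] :=
    pselect (exists eta, A eta /\ mdist (q i) (p eta) < r).
    by exists eta.
  by exists x0 => zeta ? ?; exfalso; apply: no; exists zeta.
exists c => zeta Azeta.
have [|i qi] := qP (p zeta).
  by apply: le_lt_trans (close _ _ A0 Azeta) _; rewrite ltrDl.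
have [Aci qci] := cP i _ Azeta qi; exists i; split => // x y cx zy.
have [ap /(_ _ cx) px] := pP (c i); have [aq /(_ _ zy) qy] := pP zeta.
move: px qy; apply: filterS2 => j px qy.
have pq : t - r - 2 * delta <= gp a (p (c i)) (p zeta).
  have := metric_triangle (p (c i)) (q i) (p zeta).
  rewrite (metric_sym _ (q i)) /gp.
  by rewrite (metric_sym (p (c i)) a) (metric_sym (p zeta) a) ap aq; lra.
have xp : t - r - 2 * delta <= gp a (x j) (p (c i)).
  by rewrite gromov_prodC; apply: le_trans px; lra.
have qy' : t - r - 2 * delta - delta <= gp a (p zeta) (y j).
  by apply: le_trans qy; lra.
by have := gromov_prod_quasi hyp (gromov_prod_quasi hyp xp pq) qy'; lra.
Unshelve. all: by end_near. Qed.

End Covering.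

(** * Busemann functions *)

Section Busemann.
Variables (R : realType) (X : metricType R) (delta : R).
Hypothesis hyp : delta_hyperbolic X delta.
Variables (xi : gromov_boundary X) (w : X) (u : nat -> X).
Hypothesis xiu : val xi u.
Local Notation b := (busemann xi w).
Local Notation gb := (busemann_prod (busemann xi w)).

(** Two representatives of xi give values of (p|u m)_a that differ by at most
    delta for large m, so the infimum over representatives is at most delta
    below the values along u. *)
Lemma gromov_prod_pt_near a p e : 0 < e -> \forall m \near \oo,
  gp a p (u m) - delta <= fine (gromov_prod_pt a p xi) <= gp a p (u m) + e.
Proof.
move=> e0; set P := gromov_prod_pt a p xi.
have Pu : (P <= limn_einf (fun i => (gp a p (u i))%:E))%E.
  by apply: ereal_inf_lbound; exists u.
have P0 : (0%:E <= P)%E.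
  apply: le_ereal_inf_tmp => _ [v xiv <-]; apply: le_limn_einf.
  by apply: nearW => i; exact: gromov_prod_ge0.
have Pd : (P <= (mdist p a)%:E)%E.
  rewrite leNgt; apply/negP => /lt_le_trans/(_ Pu)/lt_limn_einf[N _ NP].
  by have := NP N (leqnn N); rewrite ltNge gromov_prod_le.
have Pfin : P = (fine P)%:E.
  by rewrite fineK// fin_numE; move: P0 Pd; case: (P).
have [N uu] := boundary_rep_near2 hyp a (mdist p a + delta) xiu xiu.
have : \forall m \near \oo, (N <= m)%N by exists N.
have : ((fine P - e)%:E < limn_einf (fun i => (gp a p (u i))%:E))%E.
  by apply: lt_le_trans Pu; rewrite [ltRHS]Pfin lte_fin gtrBl.
move=> /lt_limn_einf; apply: filterS2 => m Pm Nm.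
apply/andP; split; last by lra.
rewrite -lee_fin -Pfin; apply: le_ereal_inf_tmp => _ [v xiv <-].
apply: le_limn_einf.
have := boundary_rep_near hyp a (mdist p a + delta) xiu xiv.
have : \forall j \near \oo, (N <= j)%N by exists N.
apply: filterS2 => j Nj uv; apply: (gromov_prod_quasi hyp (lexx _)).
apply: le_trans (gromov_prod_quasi hyp (uu _ _ Nm Nj) uv).
by rewrite addrK gromov_prod_le.
Qed.

Lemma busemann_near x e : 0 < e -> \forall m \near \oo,
  `|b x - (mdist (u m) x - mdist (u m) w)| <= delta + e.
Proof.
move=> e0; have := gromov_prod_pt_near x w e0.
have := gromov_prod_pt_near w x e0; apply: filterS2 => m.
rewrite /busemann; set P := fine _; set Q := fine _.
rewrite /gp (metric_sym w x) (metric_sym w (u m)) (metric_sym x (u m)).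
by move=> /andP[? ?] /andP[? ?]; rewrite ler_norml; lra.
Qed.

(** Replacing b by the distance to u m turns the product based at b into the one
    based at u m, up to an additive constant. *)
Lemma busemann_prod_near x y e : 0 < e -> \forall m \near \oo,
  `|gb x y - (gp (u m) x y - mdist (u m) w)| <= delta + e.
Proof.
move=> e0; have := busemann_near x e0; have := busemann_near y e0.
apply: filterS2 => m; rewrite /busemann_prod /gp !ler_norml.
rewrite (metric_sym x (u m)) (metric_sym y (u m)).
by move=> /andP[? ?] /andP[? ?]; lra.
Qed.

Lemma busemann_prodC x y : gb x y = gb y x.
Proof. by rewrite /busemann_prod (metric_sym x y); lra. Qed.

(** The four-point inequality based at u m costs delta, and each of the two
    replacements of b costs delta. *)
Lemma busemann_prod_quasi : quasi_ultra gb (3 * delta).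
Proof.
have d0 := delta_ge0 hyp.
move=> x y z s sxz szy; apply/ler_addgt0Pr => e e0.
have e20 : 0 < e / 2 by rewrite divr_gt0.
near \oo => m.
have : `|gb x y - (gp (u m) x y - mdist (u m) w)| <= delta + e / 2.
  by near: m; exact: busemann_prod_near.
have : `|gb x z - (gp (u m) x z - mdist (u m) w)| <= delta + e / 2.
  by near: m; exact: busemann_prod_near.
have : `|gb z y - (gp (u m) z y - mdist (u m) w)| <= delta + e / 2.
  by near: m; exact: busemann_prod_near.
rewrite !ler_norml => /andP[_ zy] /andP[_ xz] /andP[xy _].
have hxz : s + mdist (u m) w - delta - e / 2 <= gp (u m) x z by lra.
have hzy : s + mdist (u m) w - delta - e / 2 <= gp (u m) z y by lra.
have := gromov_prod_quasi hyp hxz hzy; lra.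
Unshelve. all: by end_near. Qed.

Lemma gromov_prod_change_base a x y :
  gp a x y - mdist a w = gp w x y - gp w x a - gp w y a.
Proof. by rewrite /gp; lra. Qed.

(** The index m in [busemann_near] depends on x.  Where products with xi are
    bounded by S a single one suffices: d(a, x) - d(a, w) is determined by
    d(x, w) and (x|a)_w, and (x|a)_w changes by at most delta as a runs through
    terms of u whose mutual products exceed S by more than delta. *)
Lemma busemann_approx S : exists a, forall x,
  (\forall m \near \oo, gp w x (u m) <= S) ->
  `|b x - (mdist a x - mdist a w)| <= 3 * delta + 1.
Proof.
have d0 := delta_ge0 hyp.
have [N uu] := boundary_rep_near2 hyp w (S + delta + 1) xiu xiu.
exists (u N) => x xS; near \oo => m.
have xmS : gp w x (u m) <= S by near: m.
have Nm : (N <= m)%N by near: m; exists N.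
have : `|b x - (mdist (u m) x - mdist (u m) w)| <= delta + 1.
  by near: m; exact: busemann_near.
have h1 : gp w x (u m) - delta <= gp w x (u N).
  apply: (gromov_prod_quasi hyp (lexx _)); apply: le_trans (uu _ _ Nm _) => //.
  by lra.
have h2 : gp w x (u N) - delta <= gp w x (u m).
  have [xS1|Sx] := leP (gp w x (u N)) (S + delta + 1).
    apply: (gromov_prod_quasi hyp (lexx _)); apply: le_trans xS1 _.
    exact: uu.
  have := gromov_prod_quasi hyp (ltW Sx) (uu _ _ (leqnn N) Nm); lra.
move: h1 h2; rewrite /gp !ler_norml.
rewrite (metric_sym x (u m)) (metric_sym x (u N)) => h1 h2 /andP[h3 h4].
by apply/andP; split; lra.
Unshelve. all: by end_near. Qed.

(** For m large, (x|y)_b is about (x|y)_w - (x|u m)_w - (y|u m)_w, and the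
    subtracted terms are bounded since x and y do not converge to xi. *)
Lemma busemann_prod_ninfty xi1 xi2 : xi1 <> xi -> xi2 <> xi ->
  boundary_prod gb xi1 xi2 != -oo%E.
Proof.
have d0 := delta_ge0 hyp.
move=> /(gromov_prod_bounded hyp w)/(_ xiu)[S1 S1P].
move=> /(gromov_prod_bounded hyp w)/(_ xiu)[S2 S2P].
rewrite -ltNye; apply: (@lt_le_trans _ _ (- S1 - S2 - delta - 1)%:E).
  exact: ltNyr.
apply: boundary_prod_ge => x y /S1P[N1 N1P] /S2P[N2 N2P].
exists (maxn N1 N2) => // i /=; rewrite geq_max => /andP[i1 i2].
near \oo => m.
have m1 : (N1 <= m)%N by near: m; exists N1.
have m2 : (N2 <= m)%N by near: m; exists N2.
have : `|gb (x i) (y i) - (gp (u m) (x i) (y i) - mdist (u m) w)| <= delta + 1.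
  by near: m; exact: busemann_prod_near.
have := N1P _ _ i1 m1; have := N2P _ _ i2 m2.
have := gromov_prod_ge0 w (x i) (y i).
rewrite gromov_prod_change_base ler_norml => ? ? ? /andP[? ?]; lra.
Unshelve. all: by end_near. Qed.

(** Let z represent xi0.  If (x|u m)_w is large, then (z|x)_w is about
    (z|u m)_w, the formula (z|x)_b = (z|x)_w - (z|u m)_w - (x|u m)_w shows that
    (z|x)_b is about - (x|u m)_w, and this being above t bounds (x|u m)_w. *)
Lemma busemann_level_bounded xi0 t : xi0 <> xi ->
  exists S, forall (eta : gromov_boundary X) x,
    val eta x -> (t%:E < boundary_prod gb xi0 eta)%E ->
    \forall i \near \oo, \forall m \near \oo, gp w (x i) (u m) <= S.
Proof.
have d0 := delta_ge0 hyp.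
move=> /(gromov_prod_bounded hyp w)/(_ xiu)[S0 S0P].
have [z xi0z] := boundary_rep_exists xi0; have [N zu] := S0P _ xi0z.
exists (Num.max (S0 + delta) (2 * delta + 1 - t)) => eta x etax tg.
have := boundary_prod_gt tg xi0z etax.
have NP : \forall i \near \oo, (N <= i)%N by exists N.
move: (NP); apply: filterS2 => i Ni tzx.
have := busemann_prod_near (z i) (x i) ltr01.
move: NP; apply: filterS2 => m Nm.
rewrite gromov_prod_change_base ler_norml => /andP[_ h].
have zum := zu _ _ Ni Nm.
rewrite leNgt gt_max; apply/negP => /andP[k1 k2].
suff : gp w (z i) (x i) - delta <= gp w (z i) (u m) by lra.
have [zx|xz] := leP (gp w (z i) (x i)) (gp w (x i) (u m)).
  exact: (gromov_prod_quasi hyp (lexx _)).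
have := gromov_prod_quasi hyp (ltW xz) (lexx _); lra.
Qed.

End Busemann.

(** * Doubling of the boundary metrics *)

Section Doubling.
Variables (R : realType) (X : metricType R) (delta : R).
Hypotheses (hyp : delta_hyperbolic X delta) (geo : geodesic_space X).
Hypothesis growth : bounded_growth_at_some_scale X.

Lemma gromov_prod_ninfty w (xi eta : gromov_boundary X) :
  boundary_prod (gp w) xi eta != -oo%E.
Proof.
rewrite -ltNye; apply: (@lt_le_trans _ _ 0%:E); first exact: ltNyr.
apply: boundary_prod_ge => x y _ _; apply: nearW => i.
exact: gromov_prod_ge0.
Qed.

Lemma doubling_bourdon (w : X) (eps : R) : bourdon_parameter delta eps ->
  doubling (bourdon_metric w eps).
Proof.
move=> [eps0 _ epsd].
apply: (@doubling_boundary_gauge _ _ _ id (gp w) delta) => //.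
- exact: gromov_prod_quasi.
- exact: delta_ge0 hyp.
(* exp(2/5) <= 2 because exp(-2/5) >= 1 - 2/5. *)
- have small : 2 * eps * delta <= 2 / 5 by lra.
  have := expR_ge1Dx (- (2 * eps * delta)); rewrite expRN => inv.
  rewrite -lef_pV2 ?posrE ?expR_gt0//; apply: le_trans inv; lra.
- by move=> xi eta; exact: gromov_prod_ninfty.
move=> L; have [I cov] := boundary_covering hyp geo growth (L + delta).
exists I => xi t.
have [|c cP] := cov _ id [set eta | t%:E < boundary_prod (gp w) xi eta]%E xi w
    (t - delta).
  have [z xiz] := boundary_rep_exists xi.
  move=> eta zeta x y /= teta tzeta etax zetay.
  have := boundary_prod_gt teta xiz etax.
  have := boundary_prod_gt tzeta xiz zetay.
  apply: filterS2 => i /ltW zy /ltW zx.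
  by apply: gromov_prod_quasi hyp _ _ _ _ _ _ zy; rewrite gromov_prodC.
exists c => zeta /cP[i [_ ci]]; exists i; apply: boundary_prod_ge => x y cx zy.
by have := ci _ _ cx zy; apply: filterS => j; lra.
Qed.

Lemma doubling_hamenstadt (xi : gromov_boundary X) (w : X) (eps : R) :
  hamenstadt_parameter delta eps -> doubling (@hamenstadt_metric R X xi w eps).
Proof.
move=> [eps0 epsd]; have d0 := delta_ge0 hyp.
have [u xiu] := boundary_rep_exists xi.
pose gb := busemann_prod (busemann xi w).
have quasi : quasi_ultra gb (3 * delta) := busemann_prod_quasi hyp xiu.
have punctured (y : punctured_boundary xi) : val y <> xi.
  by have := valP y; rewrite inE.
apply: (@doubling_boundary_gauge _ _ (punctured_boundary xi) val gb (3 * delta)) => //.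
- by rewrite mulr_ge0.
- apply: le_trans epsd; rewrite ler_expR.
  by have := mulr_ge0 (ltW eps0) d0; lra.
- by move=> y z; exact: (busemann_prod_ninfty hyp w xiu (punctured y) (punctured z)).
move=> L.
(* The comparison with the base point a costs 3 delta + 1 twice and the
   four-point inequality 3 delta. *)
have [I cov] := boundary_covering hyp geo growth (L + 9 * delta + 2).
exists I => x0 t.
have [S SP] := busemann_level_bounded hyp w xiu t (punctured x0).
have [a aP] := busemann_approx hyp w xiu S.
pose A := [set y : punctured_boundary xi |
  (t%:E < boundary_prod gb (val x0) (val y))%E].
have gb_near eta zeta x y : A eta -> A zeta -> val (val eta) x ->
    val (val zeta) y -> \forall i \near \oo,
    `|gb (x i) (y i) - (gp a (x i) (y i) - mdist a w)| <= 3 * delta + 1.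
  move=> /SP SA /SP SB /SA + /SB; apply: filterS2 => i /aP + /aP.
  rewrite /gb /busemann_prod /gp !ler_norml.
  rewrite (metric_sym (x i) a) (metric_sym (y i) a).
  by move=> /andP[? ?] /andP[? ?]; lra.
have [|c cP] := cov _ val A x0 a (t + mdist a w - 6 * delta - 1).
  have [z x0z] := boundary_rep_exists (val x0).
  move=> eta zeta x y Aeta Azeta etax zetay.
  have := gb_near _ _ _ _ Aeta Azeta etax zetay.
  have := boundary_prod_gt Azeta x0z zetay.
  have := boundary_prod_gt Aeta x0z etax.
  apply: filterS3 => i /ltW zx /ltW zy; rewrite ler_norml => /andP[_ h].
  have xz : t <= gb (x i) (z i) by rewrite /gb busemann_prodC.
  have := quasi _ _ _ _ xz zy; lra.
exists c => zeta Az; have [i [Ac ci]] := cP _ Az; exists i.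
apply: boundary_prod_ge => x y cx zy.
have := gb_near _ _ _ _ Ac Az cx zy; have := ci _ _ cx zy.
by apply: filterS2 => j h; rewrite ler_norml => /andP[h1 _]; lra.
Qed.

End Doubling.

Theorem corollary1p3 (R : realType) (X : metricType R)
    (hyp : gromov_hyperbolic X) (geo : geodesic_space X)
    (growth : bounded_growth_at_some_scale X) :
  (forall (delta : R) (w : X) (eps : R),
      delta_hyperbolic X delta -> bourdon_parameter delta eps ->
      doubling (bourdon_metric w eps)) /\
  (forall (delta : R) (xi : gromov_boundary X) (w : X) (eps : R),
      delta_hyperbolic X delta -> hamenstadt_parameter delta eps ->
      doubling (@hamenstadt_metric R X xi w eps)).
Proof.
by split=> [delta w|delta xi w] eps hypd par;
  [exact: doubling_bourdon par|exact: doubling_hamenstadt par].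
Qed.
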